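(* Let $A\in\mathbb{R}^{m\times n}$ be a non-zero matrix (possibly rank-deficient), let $b\in\mathbb{R}^m$, and let $x_{LS}:=A^\dagger b$. In exact arithmetic, for every integer $T>1$, the vector $x^{(T)}$ computed after $T$ iterations of the randomized extended Kaczmarz (REK) algorithm with input $A$ and $b$ satisfies $$\mathbb{E}\,\|x^{(T)}-x_{LS}\|_2^2\ \le\ \left(1-\frac{1}{\kappa_F^2(A)}\right)^{\lfloor T/2\rfloor}\bigl(1+2\kappa^2(A)\bigr)\,\|x_{LS}\|_2^2 .$$
   Context: Notation: $\|\cdot\|_2$ is the Euclidean norm (spectral norm for matrices), $\|A\|_F$ the Frobenius norm, $A^\dagger$ the Moore-Penrose pseudo-inverse. $A^{(1)},\dots,A^{(m)}$ are the rows and $A_{(1)},\dots,A_{(n)}$ the columns of $A$, all viewed as column vectors. $\sigma_{\max}$ and $\sigma_{\min}$ are the largest and the smallest non-zero singular values of $A$. $\kappa^2(A):=\sigma_{\max}^2/\sigma_{\min}^2$ and $\kappa_F^2(A):=\|A\|_F^2\,\|A^\dagger\|_2^2=\|A\|_F^2/\sigma_{\min}^2$. REK algorithm: set $x^{(0)}=0\in\mathbb{R}^n$ and $z^{(0)}=b$. For $k=0,1,2,\dots$: pick $i_k\in\{1,\dots,m\}$ with probability $q_i=\|A^{(i)}\|_2^2/\|A\|_F^2$ and $j_k\in\{1,\dots,n\}$ with probability $p_j=\|A_{(j)}\|_2^2/\|A\|_F^2$ (all picks independent), and set $$z^{(k+1)}=z^{(k)}-\frac{\langle A_{(j_k)},z^{(k)}\rangle}{\|A_{(j_k)}\|_2^2}A_{(j_k)},\qquad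 x^{(k+1)}=x^{(k)}+\frac{b_{i_k}-z^{(k)}_{i_k}-\langle x^{(k)},A^{(i_k)}\rangle}{\|A^{(i_k)}\|_2^2}A^{(i_k)} .$$ Here $T$ iterations are performed without applying any stopping test. The expectation is over the random choices of the algorithm. *)

(* Defs.v *)
From HB Require Import structures.
From mathcomp Require Import all_boot all_order all_algebra.
From mathcomp Require Import boolp classical_sets reals.

Set Implicit Arguments.
Unset Strict Implicit.
Unset Printing Implicit Defensive.

Import Order.TTheory GRing.Theory Num.Theory.
Local Open Scope classical_set_scope.
Local Open Scope ring_scope.

Section LinearAlgebra.
Variable R : realType.

Definition dot n (u v : 'cV[R]_n) : R := \sum_i u i 0 * v i 0.

(* The norm [`|x|] that MathComp-Analysis puts on matrices is the max norm. *)
Definition norm2 n (u : 'cV[R]_n) : R := Num.sqrt (dot u u).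

Definition normF m n (A : 'M[R]_(m, n)) : R :=
  Num.sqrt (\sum_i \sum_j A i j ^+ 2).

(* Taking the unit ball rather than the unit sphere keeps the set nonempty
   when n = 0. *)
Definition specnorm m n (A : 'M[R]_(m, n)) : R :=
  sup [set norm2 (A *m x) | x in [set x : 'cV[R]_n | norm2 x <= 1]].

(* When m < n the square roots of the eigenvalues of A^T A comprise, besides
   the usual min(m, n) singular values, the value 0; this affects neither the
   nonzero singular values nor the largest one. *)
Definition singular_value m n (A : 'M[R]_(m, n)) (s : R) : Prop :=
  0 <= s /\ eigenvalue (A^T *m A) (s ^+ 2).

(* The sets below are finite, and nonempty when A != 0, so that [sup] and [inf]
   are then a maximum and a minimum. *)
Definition sigma_max m n (A : 'M[R]_(m, n)) : R :=
  sup [set s | singular_value A s].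

Definition sigma_min m n (A : 'M[R]_(m, n)) : R :=
  inf [set s | singular_value A s /\ s != 0].

Definition moore_penrose m n (A : 'M[R]_(m, n)) (X : 'M[R]_(n, m)) : Prop :=
  [/\ A *m X *m A = A, X *m A *m X = X,
      (A *m X)^T = A *m X & (X *m A)^T = X *m A].

(* MathComp's [pinvmx] is only a generalized inverse; it does not satisfy the
   two symmetry conditions. *)
Definition mpinv m n (A : 'M[R]_(m, n)) : 'M[R]_(n, m) :=
  xget 0 [set X | moore_penrose A X].

Lemma moore_penrose_uniq m n (A : 'M[R]_(m, n)) X Y :
  moore_penrose A X -> moore_penrose A Y -> X = Y.
Proof.
move=> [AXA XAX AXs XAs] [AYA YAY AYs YAs].
have eAX : A *m X = A *m Y.
  have h : A *m Y *m (A *m X) = A *m X by rewrite mulmxA AYA.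
  by rewrite -AXs -h trmx_mul AXs AYs mulmxA AXA.
have eXA : X *m A = Y *m A.
  have h : X *m A *m (Y *m A) = X *m A by rewrite -mulmxA (mulmxA A) AYA.
  by rewrite -XAs -h trmx_mul XAs YAs -mulmxA (mulmxA A) AXA.
by rewrite -XAX eXA -mulmxA eAX mulmxA.
Qed.

Lemma gram_unit k n (B : 'M[R]_(k, n)) : row_free B -> B *m B^T \in unitmx.
Proof.
move=> fB; rewrite -row_free_unit -kermx_eq0; apply/rowV0P => u.
move/sub_kermxP; rewrite mulmxA => uBB.
have : (u *m B) *m (u *m B)^T = 0.
  by rewrite trmx_mul mulmxA uBB mul0mx.
move/matrixP/(_ 0 0); rewrite !mxE => /eqP.
rewrite psumr_eq0; last by move=> i _; rewrite [X in _ * X]mxE -expr2 sqr_ge0.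
move/allP => h; have uB : u *m B = 0.
  apply/rowP => i; have := h i (mem_index_enum _).
  by rewrite [X in _ * X]mxE mulf_eq0 orbb => /eqP ->; rewrite mxE.
by apply: (row_free_inj fB); rewrite uB mul0mx.
Qed.

Lemma mpinvP m n (A : 'M[R]_(m, n)) : moore_penrose A (mpinv A).
Proof.
suff [X AX] : exists X, moore_penrose A X by exact: (xgetPex 0 (ex_intro _ X AX)).
have Gu : row_base A *m (row_base A)^T \in unitmx.
  exact/gram_unit/row_base_free.
have Hu : (col_base A)^T *m col_base A \in unitmx.
  rewrite -[X in _ *m X]trmxK; apply: gram_unit.
  by rewrite /row_free mxrank_tr; exact: col_base_full.
move: (mulmx_base A) Gu Hu; move: (col_base A) (row_base A) => C B.
move: (\rank A) C B => r C B <- Gu Hu.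
have Gs : (invmx (B *m B^T))^T = invmx (B *m B^T).
  by rewrite trmx_inv trmx_mul trmxK.
have Hs : (invmx (C^T *m C))^T = invmx (C^T *m C).
  by rewrite trmx_inv trmx_mul trmxK.
pose X := B^T *m invmx (B *m B^T) *m (invmx (C^T *m C) *m C^T).
have CX : C *m B *m X = C *m invmx (C^T *m C) *m C^T.
  rewrite /X -!mulmxA; congr (_ *m _); rewrite !mulmxA.
  by rewrite mulmxV // mul1mx.
have XB : X *m (C *m B) = B^T *m invmx (B *m B^T) *m B.
  by rewrite /X -!mulmxA; congr (_ *m (_ *m _)); rewrite !mulmxA -(mulmxA _ _ C) mulVmx // mul1mx.
exists X; split.
- by rewrite CX -!mulmxA; congr (_ *m _); rewrite (mulmxA _ C) mulmxA mulVmx // mul1mx.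
- rewrite XB /X -!mulmxA; congr (_ *m (_ *m _)).
  by rewrite (mulmxA B) (mulmxA (B *m B^T)) mulmxV // mul1mx.
- by rewrite CX !trmx_mul trmxK Hs mulmxA.
- by rewrite XB !trmx_mul trmxK Gs mulmxA.
Qed.

Definition kappa_sq m n (A : 'M[R]_(m, n)) : R :=
  sigma_max A ^+ 2 / sigma_min A ^+ 2.

Definition kappaF_sq m n (A : 'M[R]_(m, n)) : R :=
  normF A ^+ 2 * specnorm (mpinv A) ^+ 2.

Definition x_LS m n (A : 'M[R]_(m, n)) (b : 'cV[R]_m) : 'cV[R]_n :=
  mpinv A *m b.

End LinearAlgebra.

Section REK.
Variables (R : realType) (m n : nat) (A : 'M[R]_(m, n)) (b : 'cV[R]_m).

Definition rowv (i : 'I_m) : 'cV[R]_n := (row i A)^T.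

Definition row_prob (i : 'I_m) : R := norm2 (rowv i) ^+ 2 / normF A ^+ 2.

Definition col_prob (j : 'I_n) : R := norm2 (col j A) ^+ 2 / normF A ^+ 2.

(* A state is a pair (x, z). A zero row or column, picked with probability 0,
   leaves x or z unchanged, since [_ / 0 = 0]. The update of x uses the value of
   z before the step. *)
Definition rek_step (s : 'cV[R]_n * 'cV[R]_m) (ij : 'I_m * 'I_n) :
    'cV[R]_n * 'cV[R]_m :=
  let: (x, z) := s in let: (i, j) := ij in
  (x + ((b i 0 - z i 0 - dot x (rowv i)) / norm2 (rowv i) ^+ 2) *: rowv i,
   z - (dot (col j A) z / norm2 (col j A) ^+ 2) *: col j A).

(* The iterate x^(k) after the k picks listed, in order, in [picks]. *)
Definition rek_x (picks : seq ('I_m * 'I_n)) : 'cV[R]_n :=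
  (foldl rek_step (0, b) picks).1.

(* By independence, a sequence of picks has as probability the product of the
   probabilities of its picks. *)
Definition rek_expectation (T : nat) (f : T.-tuple ('I_m * 'I_n) -> R) : R :=
  \sum_(w : T.-tuple ('I_m * 'I_n))
    (\prod_(k < T) (row_prob (tnth w k).1 * col_prob (tnth w k).2)) * f w.

End REK.

(* Main.v *)
Require Import Defs.
From HB Require Import structures.
From mathcomp Require Import all_boot all_order all_algebra.
From mathcomp Require Import boolp classical_sets reals.
From mathcomp Require Import ring lra zify.

Import Order.TTheory GRing.Theory Num.Theory.
Local Open Scope ring_scope.

(** Write X for the pseudo-inverse of A, F for its Frobenius norm, t = ||X||_2,
    x* = X b, and split b = A x* + c, where A^T c = 0.  The errors are
    e = x - x* and d = z - c.  They start in the row space and in the column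
    space of A, and stay there, since each step moves x along a row and z along
    a column.

    One step replaces d by its projection orthogonal to the picked column, and
    replaces e by its projection orthogonal to the picked row plus a multiple of
    that row with coefficient -d_i / |a_i|^2.  By Pythagoras the squared
    denominators cancel against the sampling probabilities, and averaging gives
    [kaczmarz_step_mean]:
      E |d'|^2 <= |d|^2 - |A^T d|^2 / F^2,
      E |e'|^2 <= |e|^2 - |A e|^2 / F^2 + |d|^2 / F^2.
    On the row and column spaces A and A^T shrink norms by at most the factor
    1 / t, so with the rate r = 1 - 1 / (F t)^2 these read E |d'|^2 <= r |d|^2
    and E |e'|^2 <= r |e|^2 + |d|^2 / F^2.  The two-term recurrence solves to
      E |e_T|^2 <= r^T |e_0|^2 + T r^(T-1) |d_0|^2 / F^2,
    which is [rek_value_bound].  Here |e_0| = |x*|, |d_0| = |A x*| is at most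
    sigma_max |x*|, and 1 / F^2 = (1 - r) / sigma_min^2, so that the second term
    is at most T r^(T-1) (1 - r) kappa^2 |x*|^2.  A geometric series shows
    T r^(T-1) (1 - r) <= 2 r^(T/2) ([geometric_half]), whence the claim.

    The spectral input is that ||A||_2 is at most sigma_max and that
    sigma_min = 1 / t.  It rests on [specnorm_singular_value]: the spectral norm
    is itself a singular value.  Indeed, if s = ||A||_2 were not one, the positive
    semidefinite matrix s^2 I - A^T A would be invertible, hence coercive
    ([psd_unit_coercive]), and s would not be the least bound. *)

(** * Inner products, norms and Cauchy-Schwarz *)

Lemma dotC {R : realType} {n} (u v : 'cV[R]_n) : dot u v = dot v u.
Proof. by apply: eq_bigr => i _; rewrite mulrC. Qed.

Lemma dotDr {R : realType} {n} (u v w : 'cV[R]_n) :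
  dot u (v + w) = dot u v + dot u w.
Proof.
by rewrite /dot -big_split /=; apply: eq_bigr => i _; rewrite mxE mulrDr.
Qed.

Lemma dotZr {R : realType} {n} (c : R) (u v : 'cV[R]_n) :
  dot u (c *: v) = c * dot u v.
Proof.
by rewrite /dot mulr_sumr; apply: eq_bigr => i _; rewrite mxE mulrCA.
Qed.

Lemma dotDl {R : realType} {n} (u v w : 'cV[R]_n) :
  dot (v + w) u = dot v u + dot w u.
Proof. by rewrite dotC dotDr !(dotC u). Qed.

Lemma dotZl {R : realType} {n} (c : R) (u v : 'cV[R]_n) :
  dot (c *: v) u = c * dot v u.
Proof. by rewrite dotC dotZr (dotC u). Qed.

Lemma dotNr {R : realType} {n} (u v : 'cV[R]_n) : dot u (- v) = - dot u v.
Proof. by rewrite -scaleN1r dotZr mulN1r. Qed.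

Lemma dotNl {R : realType} {n} (u v : 'cV[R]_n) : dot (- v) u = - dot v u.
Proof. by rewrite dotC dotNr dotC. Qed.

Lemma dot0r {R : realType} {n} (u : 'cV[R]_n) : dot u 0 = 0.
Proof. by rewrite -(scale0r 0) dotZr mul0r. Qed.

Lemma dot_mulmxl {R : realType} {m n} (A : 'M[R]_(m, n)) u v :
  dot (A *m u) v = dot u (A^T *m v).
Proof.
have dotE k (x y : 'cV[R]_k) : dot x y = (x^T *m y) 0 0.
  by rewrite mxE; apply: eq_bigr => i _; rewrite mxE.
by rewrite !dotE trmx_mul mulmxA.
Qed.

Lemma dot_ge0 {R : realType} {n} (u : 'cV[R]_n) : 0 <= dot u u.
Proof. by apply: sumr_ge0 => i _; rewrite -expr2 sqr_ge0. Qed.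

Lemma dot_eq0 {R : realType} {n} (u : 'cV[R]_n) : (dot u u == 0) = (u == 0).
Proof.
apply/eqP/eqP => [|->]; last exact: dot0r.
move/eqP; rewrite psumr_eq0; last by move=> i _; rewrite -expr2 sqr_ge0.
move/allP => h; apply/colP => i; have := h i (mem_index_enum _).
by rewrite mulf_eq0 orbb => /eqP ->; rewrite mxE.
Qed.

Lemma norm2_sq {R : realType} {n} (u : 'cV[R]_n) : norm2 u ^+ 2 = dot u u.
Proof. by rewrite sqr_sqrtr // dot_ge0. Qed.

Lemma mulmx_dot_rowv {R : realType} {m n} (A : 'M[R]_(m, n)) v i :
  (A *m v) i 0 = dot (rowv A i) v.
Proof. by rewrite mxE; apply: eq_bigr => j _; rewrite !mxE. Qed.

Lemma sum_sq_ge0 {R : realType} {m n} (A : 'M[R]_(m, n)) :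
  0 <= \sum_i \sum_j A i j ^+ 2.
Proof. by do 2![apply: sumr_ge0 => ? _]; rewrite sqr_ge0. Qed.

Lemma normF_sq {R : realType} {m n} (A : 'M[R]_(m, n)) :
  normF A ^+ 2 = \sum_i dot (rowv A i) (rowv A i).
Proof.
rewrite sqr_sqrtr ?sum_sq_ge0 //; apply: eq_bigr => i _.
by apply: eq_bigr => j _; rewrite !mxE expr2.
Qed.

Lemma normF_tr {R : realType} {m n} (A : 'M[R]_(m, n)) : normF A^T = normF A.
Proof.
rewrite /normF exchange_big /=; congr Num.sqrt.
by apply: eq_bigr => i _; apply: eq_bigr => j _; rewrite mxE.
Qed.

Lemma normF_sq_gt0 {R : realType} {m n} (A : 'M[R]_(m, n)) :
  A != 0 -> 0 < normF A ^+ 2.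
Proof.
move=> A0; rewrite lt0r sqr_ge0 andbT; apply: contraNN A0.
rewrite normF_sq psumr_eq0 => [|i _]; last exact: dot_ge0.
move/allP => h; apply/eqP/matrixP => i j; have := h i (mem_index_enum _).
by rewrite dot_eq0 => /eqP/colP/(_ j); rewrite !mxE.
Qed.

(** Both Cauchy-Schwarz inequalities below come from the nonnegative quadratic
    s |-> q(u + s v); the form q may be degenerate, so c = 0 is included. *)
Lemma discriminant_le {R : realType} (a b c : R) :
  0 <= c -> (forall s, 0 <= a + 2 * b * s + c * s ^+ 2) -> b ^+ 2 <= a * c.
Proof.
move=> c0 h; have [c1|c1] := eqVneq c 0; last first.
  have cp : 0 < c by rewrite lt0r c1.
  have := h (- b / c); rewrite -(pmulr_rge0 _ cp).
  have -> : c * (a + 2 * b * (- b / c) + c * (- b / c) ^+ 2) = a * c - b ^+ 2.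
    by field.
  by rewrite subr_ge0.
rewrite c1 mulr0; have [->|b0] := eqVneq b 0; first by rewrite expr0n.
(* The quadratic is affine with slope 2 b: it takes the value -1 somewhere. *)
have := h (- (a + 1) / (2 * b)); rewrite c1 mul0r addr0.
have -> : a + 2 * b * (- (a + 1) / (2 * b)) = -1 by field; rewrite b0.
by rewrite ler0N1.
Qed.

Lemma psd_cauchy_schwarz {R : realType} {n} (M : 'M[R]_n) (u v : 'cV[R]_n) :
  M^T = M -> (forall x, 0 <= dot x (M *m x)) ->
  dot u (M *m v) ^+ 2 <= dot u (M *m u) * dot v (M *m v).
Proof.
move=> Ms M0; apply: discriminant_le => // s.
have := M0 (u + s *: v).
rewrite mulmxDr -scalemxAr !(dotDl, dotDr, dotZl, dotZr).
have -> : dot v (M *m u) = dot u (M *m v) by rewrite dotC dot_mulmxl Ms.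
by move=> h; apply: le_trans h _; lra.
Qed.

Lemma cauchy_schwarz {R : realType} {n} (u v : 'cV[R]_n) :
  dot u v ^+ 2 <= dot u u * dot v v.
Proof.
have := @psd_cauchy_schwarz R n 1%:M u v (trmx1 _ _).
by rewrite !mul1mx; apply=> x; rewrite mul1mx dot_ge0.
Qed.

(** * The spectral norm is a singular value *)

Lemma normF_bound {R : realType} {m n} (A : 'M[R]_(m, n)) v :
  dot (A *m v) (A *m v) <= normF A ^+ 2 * dot v v.
Proof.
rewrite normF_sq mulr_suml; apply: ler_sum => i _.
by rewrite mulmx_dot_rowv -expr2 cauchy_schwarz.
Qed.

(** An invertible positive semidefinite M is positive definite, quantitatively:
    Cauchy-Schwarz for the form of M applied to x and M x gives
    |M x|^2 <= L (x . M x), where L bounds M, and |x|^2 <= K |M x|^2, where K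
    bounds the inverse of M. *)
Lemma psd_unit_coercive {R : realType} {n} (M : 'M[R]_n) :
  M^T = M -> (forall x, 0 <= dot x (M *m x)) -> M \in unitmx ->
  exists2 c : R, 0 < c & forall x, c * dot x x <= dot x (M *m x).
Proof.
move=> Ms M0 Mu.
(* Adding 1 makes the two bounds positive even when n = 0. *)
pose L := normF M ^+ 2 + 1; pose K := normF (invmx M) ^+ 2 + 1.
have L0 : 0 < L by rewrite ltr_wpDl ?sqr_ge0.
have K0 : 0 < K by rewrite ltr_wpDl ?sqr_ge0.
have opL y : dot y (M *m y) <= L * dot y y.
  have h1 := cauchy_schwarz y (M *m y).
  have h2 := normF_bound M y; have y0 := dot_ge0 y.
  have F0 := sqr_ge0 (normF M).
  rewrite -ler_sqr ?nnegrE ?M0 ?mulr_ge0 ?(ltW L0) //.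
  apply: le_trans h1 _; rewrite /L; set a := dot (M *m y) _ in h2 *.
  set d := dot y y in h2 y0 *; set F := normF M ^+ 2 in h2 F0 *.
  have : d * a <= d * (F * d) by rewrite ler_wpM2l.
  by move=> h; apply: le_trans h _; nra.
exists (L * K)^-1; first by rewrite invr_gt0 mulr_gt0.
move=> x; rewrite ler_pdivrMl ?mulr_gt0 //.
have h : dot (M *m x) (M *m x) <= L * dot x (M *m x).
  have [->|z0] := eqVneq (M *m x) 0; first by rewrite !dot0r mulr0.
  have zp : 0 < dot (M *m x) (M *m x) by rewrite lt0r dot_eq0 z0 dot_ge0.
  have := @psd_cauchy_schwarz _ _ M x (M *m x) Ms M0.
  have -> : dot x (M *m (M *m x)) = dot (M *m x) (M *m x).
    by rewrite dot_mulmxl Ms.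
  move=> h1; rewrite -(ler_pM2r zp) -expr2; apply: le_trans h1 _.
  by rewrite mulrAC mulrC ler_wpM2r // opL.
have h2 := normF_bound (invmx M) (M *m x); rewrite mulKmx // in h2.
rewrite (mulrC L) -mulrA; apply: le_trans h2 _.
apply: ler_pM; rewrite ?sqr_ge0 ?dot_ge0 //.
by rewrite lerDl.
Qed.

Lemma norm2Z {R : realType} {n} (c : R) (u : 'cV[R]_n) :
  norm2 (c *: u) = `|c| * norm2 u.
Proof.
by rewrite /norm2 dotZl dotZr mulrA -expr2 sqrtrM ?sqr_ge0 // sqrtr_sqr.
Qed.

Lemma norm2_mulmx_le {R : realType} {m n} (A : 'M[R]_(m, n)) K x :
  0 <= K -> dot (A *m x) (A *m x) <= K ^+ 2 * dot x x ->
  norm2 (A *m x) <= K * norm2 x.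
Proof.
move=> K0 h; rewrite -ler_sqr ?nnegrE ?mulr_ge0 ?sqrtr_ge0 //.
by rewrite exprMn !norm2_sq.
Qed.

Lemma specnorm_ub {R : realType} {m n} (A : 'M[R]_(m, n)) :
  ubound [set norm2 (A *m x) | x in [set x : 'cV[R]_n | norm2 x <= 1]]%classic
    (specnorm A).
Proof.
apply: ub_le_sup; exists (normF A) => _ [x /= x1 <-].
apply: le_trans (norm2_mulmx_le _ _ _ _ (normF_bound _ _)) _; first exact: sqrtr_ge0.
by rewrite ler_piMr // sqrtr_ge0.
Qed.

Lemma specnorm_ge0 {R : realType} {m n} (A : 'M[R]_(m, n)) : 0 <= specnorm A.
Proof.
apply: le_trans (sqrtr_ge0 _) (@specnorm_ub _ _ _ A _ (ex_intro2 _ _ 0 _ erefl)).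
by rewrite /= /norm2 dot0r sqrtr0.
Qed.

Lemma specnorm_bound {R : realType} {m n} (A : 'M[R]_(m, n)) x :
  dot (A *m x) (A *m x) <= specnorm A ^+ 2 * dot x x.
Proof.
have [->|x0] := eqVneq x 0; first by rewrite mulmx0 !dot0r mulr0.
have xp : 0 < norm2 x by rewrite sqrtr_gt0 lt0r dot_eq0 x0 dot_ge0.
rewrite -!norm2_sq -exprMn ler_sqr ?nnegrE ?mulr_ge0 ?sqrtr_ge0 ?specnorm_ge0 //.
rewrite -ler_pdivrMr //; apply: specnorm_ub.
exists ((norm2 x)^-1 *: x).
  by rewrite /= norm2Z gtr0_norm ?invr_gt0 // mulVf ?gt_eqF.
by rewrite -scalemxAr norm2Z gtr0_norm ?invr_gt0 // mulrC.
Qed.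

Lemma specnorm_le {R : realType} {m n} (A : 'M[R]_(m, n)) K :
  0 <= K -> (forall x, dot (A *m x) (A *m x) <= K ^+ 2 * dot x x) ->
  specnorm A <= K.
Proof.
move=> K0 h; apply: ge_sup.
  by exists (norm2 (A *m 0)), 0; rewrite //= /norm2 dot0r sqrtr0.
move=> _ [x /= x1 <-]; apply: le_trans (norm2_mulmx_le _ _ _ K0 (h x)) _.
by rewrite ler_piMr.
Qed.

Lemma specnorm_gt0 {R : realType} {m n} (A : 'M[R]_(m, n)) :
  A != 0 -> 0 < specnorm A.
Proof.
move=> A0; rewrite lt0r specnorm_ge0 andbT; apply: contraNN A0 => /eqP s0.
apply/eqP/matrixP => i j; have := specnorm_bound A (delta_mx j 0).
rewrite s0 expr0n mul0r => h.
have : A *m delta_mx j 0 == 0 :> 'cV_m by rewrite -dot_eq0 eq_le h dot_ge0.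
by rewrite -colE => /eqP/colP/(_ i); rewrite !mxE.
Qed.

(** Eigenvalues are defined by left eigenvectors; the Gram matrix is symmetric,
    so right eigenvectors serve as well. *)
Lemma singular_valueP {R : realType} {m n} (A : 'M[R]_(m, n)) s :
  singular_value A s <->
  0 <= s /\ exists2 v : 'cV[R]_n, v != 0 & A^T *m A *m v = s ^+ 2 *: v.
Proof.
have sym : (A^T *m A)^T = A^T *m A by rewrite trmx_mul trmxK.
split=> [] [s0 h]; split=> //.
  case/eigenvalueP: h => v vA v0; exists v^T.
    by rewrite trmx_eq0.
  by apply: trmx_inj; rewrite trmx_mul sym trmxK vA linearZ /= trmxK.
case: h => v v0 vA; apply/eigenvalueP; exists v^T.
  by rewrite -sym -trmx_mul vA linearZ.
by rewrite trmx_eq0.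
Qed.

(** If s = ||A||_2 were not a singular value, s^2 I - A^T A would be positive
    semidefinite and invertible, hence bounded below by some c > 0.  Then
    |A x|^2 <= (s^2 - c) |x|^2 for all x, against the minimality of s. *)
Lemma specnorm_singular_value {R : realType} {m n} (A : 'M[R]_(m, n)) :
  A != 0 -> singular_value A (specnorm A).
Proof.
move=> A0; split; first exact: specnorm_ge0.
set s := specnorm A; have sp : 0 < s by exact: specnorm_gt0.
pose M := (s ^+ 2)%:M - A^T *m A.
have MsE x : dot x (M *m x) = s ^+ 2 * dot x x - dot (A *m x) (A *m x).
  by rewrite /M mulmxBl mul_scalar_mx dotDr dotNr dotZr -mulmxA -dot_mulmxl.
have Ms : M^T = M by rewrite /M linearB /= tr_scalar_mx trmx_mul trmxK.
have [Mu|Mnu] := boolP (M \in unitmx); last first.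
  rewrite /eigenvalue /eigenspace kermx_eq0 row_free_unit.
  by rewrite -opprB -scaleN1r unitmxZ // unitrN1.
have M0 x : 0 <= dot x (M *m x) by rewrite MsE subr_ge0 specnorm_bound.
have [c c0 hc] := psd_unit_coercive M Ms M0 Mu.
(* [specnorm_le] wants the square of a nonnegative number; nothing yet says
   that s^2 - c is nonnegative. *)
pose d := Num.max 0 (s ^+ 2 - c).
have d0 : 0 <= d by rewrite le_max lexx.
have : s <= Num.sqrt d; last first.
  rewrite -ler_sqr ?nnegrE ?sqrtr_ge0 ?(ltW sp) // sqr_sqrtr // /d le_max.
  by case/orP; [have := exprn_gt0 2 sp|]; lra.
apply: specnorm_le; first exact: sqrtr_ge0.
move=> x; rewrite sqr_sqrtr //; have := hc x; rewrite MsE => h.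
apply: (@le_trans _ _ ((s ^+ 2 - c) * dot x x)); first by lra.
by rewrite ler_wpM2r ?dot_ge0 // le_max lexx orbT.
Qed.
Lemma le_of_sq_scaled {R : realType} {n} (s t : R) (v : 'cV[R]_n) :
  0 <= s -> 0 <= t -> v != 0 ->
  s ^+ 2 * dot v v <= t ^+ 2 * dot v v -> s <= t.
Proof.
move=> s0 t0 v0; rewrite ler_pM2r ?lt0r ?dot_eq0 ?v0 ?dot_ge0 //.
by rewrite ler_sqr.
Qed.

Lemma specnorm_le_sigma_max {R : realType} {m n} (A : 'M[R]_(m, n)) :
  A != 0 -> specnorm A <= sigma_max A.
Proof.
move=> A0; apply: ub_le_sup; last exact: specnorm_singular_value.
exists (specnorm A) => s /singular_valueP[s0 [v v0 vA]].
apply: le_of_sq_scaled v0 _; rewrite ?specnorm_ge0 //.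
by rewrite -dotZr -vA -mulmxA -dot_mulmxl specnorm_bound.
Qed.

(** * The smallest nonzero singular value and the pseudo-inverse *)

Lemma mulmx_tr_mpinv {R : realType} {m n} (A : 'M[R]_(m, n)) :
  A^T *m (A *m mpinv A) = A^T.
Proof. by have [AXA _ AXs _] := mpinvP A; rewrite -AXs -trmx_mul AXA. Qed.

Lemma mulmx_mpinv_tr {R : realType} {m n} (A : 'M[R]_(m, n)) :
  mpinv A *m A *m A^T = A^T.
Proof. by have [AXA _ _ XAs] := mpinvP A; rewrite -XAs -trmx_mul mulmxA AXA. Qed.

Lemma mpinv_neq0 {R : realType} {m n} (A : 'M[R]_(m, n)) :
  A != 0 -> mpinv A != 0.
Proof.
by have [AXA _ _ _] := mpinvP A; apply: contraNN => /eqP X0;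
  rewrite -AXA X0 mulmx0 mul0mx.
Qed.

(** The hypothesis says that v lies in the row space of A, as X A is the
    orthogonal projection onto it. *)
Lemma mulmx_lower_bound {R : realType} {m n} (A : 'M[R]_(m, n)) v :
  mpinv A *m A *m v = v ->
  dot v v <= specnorm (mpinv A) ^+ 2 * dot (A *m v) (A *m v).
Proof. by move=> {1 2}<-; rewrite -mulmxA specnorm_bound. Qed.

(** The analogue for the column space.  Rather than identifying the
    pseudo-inverse of A^T, one uses |w|^2 = (X w) . (A^T w) and
    Cauchy-Schwarz. *)
Lemma mulmx_tr_lower_bound {R : realType} {m n} (A : 'M[R]_(m, n)) w :
  A *m mpinv A *m w = w ->
  dot w w <= specnorm (mpinv A) ^+ 2 * dot (A^T *m w) (A^T *m w).
Proof.
move=> wE; have [->|w0] := eqVneq w 0; first by rewrite mulmx0 !dot0r mulr0.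
have wp : 0 < dot w w by rewrite lt0r dot_eq0 w0 dot_ge0.
rewrite -(ler_pM2r wp) -expr2.
have e : dot w w = dot (mpinv A *m w) (A^T *m w).
  by rewrite -dot_mulmxl mulmxA wE.
have h := cauchy_schwarz (mpinv A *m w) (A^T *m w); rewrite -e in h.
by apply: le_trans h _; rewrite mulrAC ler_wpM2r ?dot_ge0 // specnorm_bound.
Qed.

(** If w is an eigenvector of X^T X for t^2, then X w is one of A^T A for
    1 / t^2: indeed A^T A X = A^T and A^T X^T X = X. *)
Lemma inv_specnorm_mpinv_singular_value {R : realType} {m n} (A : 'M[R]_(m, n)) :
  A != 0 -> singular_value A (specnorm (mpinv A))^-1.
Proof.
move=> A0; have X0 := mpinv_neq0 A A0; have tp := specnorm_gt0 _ X0.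
have [_ XAX AXs XAs] := mpinvP A.
have [_ [w w0 wE]] := (singular_valueP _ _).1 (specnorm_singular_value _ X0).
apply/singular_valueP; split; first by rewrite invr_ge0 ltW.
exists (mpinv A *m w).
  apply: contraNneq w0 => Xw; move: wE; rewrite -mulmxA Xw mulmx0 => /esym/eqP.
  by rewrite scaler_eq0 expf_eq0 /= gt_eqF.
have tw : A^T *m (specnorm (mpinv A) ^+ 2 *: w) = mpinv A *m w.
  by rewrite -wE !mulmxA -trmx_mul XAs XAX.
rewrite -!mulmxA (mulmxA A) mulmxA mulmx_tr_mpinv -tw -scalemxAr scalerA.
by rewrite -exprMn mulVf ?gt_eqF // expr1n scale1r.
Qed.

(** An eigenvector of A^T A for a nonzero eigenvalue s^2 lies in the row space,
    where A shrinks norms by at most 1 / t; hence s >= 1 / t, and the value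
    1 / t is attained. *)
Lemma sigma_minE {R : realType} {m n} (A : 'M[R]_(m, n)) :
  A != 0 -> sigma_min A = (specnorm (mpinv A))^-1.
Proof.
move=> A0; have tp := specnorm_gt0 _ (mpinv_neq0 A A0).
have hA : singular_value A (specnorm (mpinv A))^-1
    /\ (specnorm (mpinv A))^-1 != 0.
  by split; [exact: inv_specnorm_mpinv_singular_value|rewrite invr_eq0 gt_eqF].
apply/eqP; rewrite eq_le; apply/andP; split.
  by apply: ge_inf hA; exists 0 => s [[]].
apply: lb_le_inf; first by exists (specnorm (mpinv A))^-1.
move=> s [/singular_valueP[s0 [v v0 vA]] sn0].
rewrite -[leLHS]mul1r ler_pdivrMr // mulrC.
have vE : mpinv A *m A *m v = v.
  apply: (@scalerI _ _ (s ^+ 2)); first by rewrite expf_neq0.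
  by rewrite scalemxAr -vA !mulmxA mulmx_mpinv_tr.
apply: le_of_sq_scaled v0 _; rewrite ?mulr_ge0 ?(ltW tp) //.
rewrite expr1n mul1r exprMn -mulrA -dotZr -vA -mulmxA -dot_mulmxl.
exact: mulmx_lower_bound.
Qed.

(** * One step of the iteration *)

Lemma row_prob_ge0 {R : realType} {m n} (A : 'M[R]_(m, n)) i : 0 <= row_prob A i.
Proof. by rewrite /row_prob divr_ge0 ?sqr_ge0. Qed.

Lemma sum_row_prob {R : realType} {m n} (A : 'M[R]_(m, n)) :
  A != 0 -> \sum_i row_prob A i = 1.
Proof.
move=> A0; rewrite -mulr_suml (eq_bigr _ (fun i _ => norm2_sq _)) -normF_sq.
by rewrite mulfV // gt_eqF // normF_sq_gt0.
Qed.

Lemma rowv_tr {R : realType} {m n} (A : 'M[R]_(m, n)) j : rowv A^T j = col j A.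
Proof. by rewrite /rowv -tr_col trmxK. Qed.

Lemma col_prob_tr {R : realType} {m n} (A : 'M[R]_(m, n)) j :
  col_prob A j = row_prob A^T j.
Proof. by rewrite /row_prob rowv_tr normF_tr. Qed.

(** With d = 0 this is the mean decrease of a randomized projection step.  In
    general the term d_i / |a_i|^2 a_i is orthogonal to the projected error, so
    it adds d_i^2 / |a_i|^2 to the squared norm.  The probability |a_i|^2 / F^2
    cancels the denominator.  The relation is not an equality because a zero row
    contributes nothing on the left but d_i^2 / F^2 on the right. *)
Lemma kaczmarz_step_mean {R : realType} {m n} (A : 'M[R]_(m, n)) (e : 'cV_n)
    (d : 'cV_m) :
  A != 0 ->
  \sum_i row_prob A i
      * norm2 (e - ((dot (rowv A i) e + d i 0) / norm2 (rowv A i) ^+ 2)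
                     *: rowv A i) ^+ 2
    <= norm2 e ^+ 2 + (norm2 d ^+ 2 - norm2 (A *m e) ^+ 2) / normF A ^+ 2.
Proof.
move=> A0; have F0 := normF_sq_gt0 A A0.
rewrite !norm2_sq -[dot e e]mul1r -(sum_row_prob A A0) mulr_suml.
rewrite -[dot d d - _]/(\sum_i _ - \sum_i _) -sumrB mulr_suml -big_split /=.
apply: ler_sum => i _; rewrite mulmx_dot_rowv /row_prob !norm2_sq.
set a := rowv A i.
rewrite !(dotDl, dotDr, dotNl, dotNr, dotZl, dotZr) (dotC e a).
have [a0|a0] := eqVneq a 0.
  rewrite a0 !(dotC 0) !dot0r !(mul0r, mulr0, addr0, subr0, add0r).
  by rewrite divr_ge0 ?(ltW F0) // -expr2 sqr_ge0.
rewrite le_eqVlt; apply: predU1l; field.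
by rewrite dot_eq0 a0 andbT; apply: contraTneq F0 => ->; rewrite expr0n ltxx.
Qed.

(** * The expected error after T steps *)

(** Starting from an arbitrary state lets one condition on the first pick
    ([rek_valueS]), as an induction on the number of steps requires. *)
Definition rek_value {R : realType} {m n} (A : 'M[R]_(m, n)) b T s
    (g : 'cV[R]_n * 'cV[R]_m -> R) : R :=
  rek_expectation A (fun w : T.-tuple _ => g (foldl (rek_step A b) s w)).

Lemma sum_tupleS {R : realType} {I : finType} {T} (F : T.+1.-tuple I -> R) :
  \sum_w F w = \sum_p \sum_(w : T.-tuple I) F [tuple of p :: w].
Proof.
rewrite pair_bigA /=.
rewrite (reindex (fun pw : I * T.-tuple I => [tuple of pw.1 :: pw.2])) //=.
exists (fun w => (thead w, [tuple of behead w])) => [[p w] _|w _] /=.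
  by congr pair; apply: val_inj.
by rewrite -tuple_eta.
Qed.

Lemma rek_value0 {R : realType} {m n} (A : 'M[R]_(m, n)) b s g :
  rek_value A b 0 s g = g s.
Proof.
rewrite /rek_value /rek_expectation (big_pred1 [tuple]) => [|w].
  by rewrite big_ord0 mul1r.
by apply/esym/eqP; exact: tuple0.
Qed.

Lemma rek_valueS {R : realType} {m n} (A : 'M[R]_(m, n)) b T s g :
  rek_value A b T.+1 s g =
  \sum_i \sum_j row_prob A i * (col_prob A j
     * rek_value A b T (rek_step A b s (i, j)) g).
Proof.
rewrite /rek_value /rek_expectation sum_tupleS [RHS]pair_bigA /=.
apply: eq_bigr => [[i j]] _ /=; rewrite !mulr_sumr; apply: eq_bigr => w _.
rewrite big_ord_recl tnth0.
rewrite (eq_bigr (fun k => row_prob A (tnth w k).1 * col_prob A (tnth w k).2)).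
  by rewrite !mulrA.
by move=> k _; rewrite tnthS.
Qed.

Definition rek_rate {R : realType} {m n} (A : 'M[R]_(m, n)) : R :=
  1 - 1 / kappaF_sq A.

Lemma kappaF_sq_gt0 {R : realType} {m n} (A : 'M[R]_(m, n)) :
  A != 0 -> 0 < kappaF_sq A.
Proof.
move=> A0.
by rewrite mulr_gt0 ?normF_sq_gt0 // exprn_gt0 // specnorm_gt0 // mpinv_neq0.
Qed.

Lemma rek_rate_le1 {R : realType} {m n} (A : 'M[R]_(m, n)) :
  A != 0 -> rek_rate A <= 1.
Proof. by move=> A0; rewrite gerBl divr_ge0 // ltW // kappaF_sq_gt0. Qed.

(** An eigenvector v for the singular value 1 / t satisfies
    |v|^2 / t^2 = |A v|^2 <= F^2 |v|^2, so (F t)^2 >= 1. *)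
Lemma rek_rate_ge0 {R : realType} {m n} (A : 'M[R]_(m, n)) :
  A != 0 -> 0 <= rek_rate A.
Proof.
move=> A0; rewrite subr_ge0 ler_pdivrMr ?kappaF_sq_gt0 // mul1r.
have [s0 [v v0 vA]] :=
  (singular_valueP _ _).1 (inv_specnorm_mpinv_singular_value A A0).
have tp := specnorm_gt0 _ (mpinv_neq0 A A0).
have vp : 0 < dot v v by rewrite lt0r dot_eq0 v0 dot_ge0.
rewrite -(ler_pM2r vp) mul1r /kappaF_sq mulrAC -ler_pdivrMr ?exprn_gt0 //.
by rewrite mulrC -exprVn -dotZr -vA -mulmxA -dot_mulmxl normF_bound.
Qed.

(** B is A or A^T; the hypothesis is provided by [mulmx_lower_bound] or
    [mulmx_tr_lower_bound]. *)
Lemma rek_rate_contraction {R : realType} {m n k l} (A : 'M[R]_(m, n))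
    (B : 'M[R]_(k, l)) v :
  A != 0 -> dot v v <= specnorm (mpinv A) ^+ 2 * dot (B *m v) (B *m v) ->
  norm2 v ^+ 2 - norm2 (B *m v) ^+ 2 / normF A ^+ 2 <= rek_rate A * norm2 v ^+ 2.
Proof.
move=> A0 h; have F0 := normF_sq_gt0 A A0.
have t0 : 0 < specnorm (mpinv A) ^+ 2.
  by rewrite exprn_gt0 // specnorm_gt0 // mpinv_neq0.
rewrite /rek_rate mulrBl !mul1r lerD2l lerN2 !norm2_sq /kappaF_sq.
by rewrite invfM -mulrA mulrC ler_pM2r ?invr_gt0 // ler_pdivrMl.
Qed.

(** The two picks of a step are independent, and each error depends on one of
    them only. *)
Lemma mean_sum {R : realType} {I J : finType} (p f : I -> R) (q g : J -> R) :
  \sum_i p i = 1 -> \sum_j q j = 1 ->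
  \sum_i \sum_j p i * (q j * (f i + g j)) = \sum_i p i * f i + \sum_j q j * g j.
Proof.
move=> p1 q1.
rewrite (eq_bigr (fun i => p i * f i + p i * \sum_j q j * g j)).
  by rewrite big_split /= -mulr_suml p1 mul1r.
move=> i _; rewrite -mulr_sumr (eq_bigr (fun j => q j * f i + q j * g j)).
  by rewrite big_split /= -mulr_suml q1 mul1r mulrDr.
by move=> j _; rewrite mulrDr.
Qed.

(** Solution of e_{k+1} <= r e_k + d_k / F^2, d_{k+1} <= r d_k.  Conditioning on
    the first pick, the induction hypothesis is linear in the squared errors
    after one step, so only their means are needed.  For T = 0 the exponent T.-1
    is 0, and the factor T makes the term vanish. *)
Lemma rek_value_bound {R : realType} {m n} (A : 'M[R]_(m, n)) b T x z :
  A != 0 ->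
  let e := x - x_LS A b in
  let d := z - (b - A *m x_LS A b) in
  mpinv A *m A *m e = e -> A *m mpinv A *m d = d ->
  rek_value A b T (x, z) (fun s => norm2 (s.1 - x_LS A b) ^+ 2)
    <= rek_rate A ^+ T * norm2 e ^+ 2
       + T%:R * rek_rate A ^+ T.-1 / normF A ^+ 2 * norm2 d ^+ 2.
Proof.
move=> A0; have F0 := normF_sq_gt0 A A0; have r0 := rek_rate_ge0 A A0.
have [AXA _ _ _] := mpinvP A.
have AT0 : A^T != 0 by rewrite trmx_eq0.
elim: T x z => [|T IH] x z e d eE dE.
  by rewrite rek_value0 expr0 mul1r !mul0r addr0.
pose e' i := e - ((dot (rowv A i) e + d i 0)
                   / norm2 (rowv A i) ^+ 2) *: rowv A i.
pose d' j := d - ((dot (rowv A^T j) d + (0 : 'cV[R]_n) j 0)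
                   / norm2 (rowv A^T j) ^+ 2) *: rowv A^T j.
(* Picked rows and columns lie in the ranges of A^T and A, so the errors stay
   in the spaces fixed by the two projections. *)
have rowvE i : rowv A i = A^T *m delta_mx i 0 by rewrite /rowv tr_row colE.
have rowv_trE j : rowv A^T j = A *m delta_mx j 0 by rewrite rowv_tr colE.
have stepE i j : rek_step A b (x, z) (i, j)
    = (e' i + x_LS A b, d' j + (b - A *m x_LS A b)).
  rewrite /= /e' /d'; congr pair.
    rewrite [RHS]addrAC subrK -scaleNr -mulNr; congr (_ + (_ / _) *: _).
    rewrite -mulmx_dot_rowv mulmxBr dotC -mulmx_dot_rowv /d !mxE.
    by ring.
  rewrite rowv_tr mxE addr0 [RHS]addrAC subrK; congr (_ - (_ / _) *: _).
  rewrite !dotDr !dotNr -rowv_tr.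
  suff -> : dot (rowv A^T j) (b - A *m x_LS A b) = 0 by rewrite subr0.
  rewrite -mulmx_dot_rowv mulmxBr /x_LS !mulmxA -(mulmxA _ A) mulmx_tr_mpinv.
  by rewrite subrr mxE.
rewrite rek_valueS.
apply: (@le_trans _ _ (\sum_i \sum_j row_prob A i * (col_prob A j *
  (rek_rate A ^+ T * norm2 (e' i) ^+ 2
   + T%:R * rek_rate A ^+ T.-1 / normF A ^+ 2 * norm2 (d' j) ^+ 2)))).
  do 2![apply: ler_sum => ? _]; rewrite !ler_wpM2l ?row_prob_ge0 //.
    by rewrite col_prob_tr row_prob_ge0.
  rewrite stepE; apply: le_trans (IH _ _ _ _) _; rewrite ?addrK //.
    by rewrite /e' mulmxBr eE -scalemxAr rowvE mulmxA mulmx_mpinv_tr.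
  by rewrite /d' mulmxBr dE -scalemxAr rowv_trE mulmxA AXA.
rewrite mean_sum ?sum_row_prob //; last first.
  by rewrite (eq_bigr _ (fun j _ => col_prob_tr A j)) sum_row_prob.
have he : \sum_i row_prob A i * norm2 (e' i) ^+ 2
    <= rek_rate A * norm2 e ^+ 2 + norm2 d ^+ 2 / normF A ^+ 2.
  apply: le_trans (kaczmarz_step_mean A e d A0) _.
  have := rek_rate_contraction A A e A0 (mulmx_lower_bound A e eE).
  by lra.
have hd : \sum_j col_prob A j * norm2 (d' j) ^+ 2 <= rek_rate A * norm2 d ^+ 2.
  rewrite (eq_bigr _ (fun j _ => congr2 _ (col_prob_tr A j) (erefl _))).
  apply: le_trans (kaczmarz_step_mean A^T d 0 AT0) _.
  have := rek_rate_contraction A A^T d A0 (mulmx_tr_lower_bound A d dE).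
  by rewrite normF_tr [norm2 0 ^+ 2]norm2_sq dot0r sub0r mulNr.
under eq_bigr do rewrite mulrCA.
under [X in _ + X]eq_bigr do rewrite mulrCA.
rewrite -!mulr_sumr.
set c := T%:R * _ / _; have c0 : 0 <= c.
  by rewrite divr_ge0 ?(ltW F0) // mulr_ge0 ?ler0n ?exprn_ge0.
apply: le_trans (lerD (ler_wpM2l (exprn_ge0 T r0) he) (ler_wpM2l c0 hd)) _.
rewrite mulrDr mulrA -exprSr -addrA lerD2l /= le_eqVlt; apply: predU1l.
have -> : c * (rek_rate A * norm2 d ^+ 2)
    = T%:R * rek_rate A ^+ T / normF A ^+ 2 * norm2 d ^+ 2.
  rewrite /c; case: (T) => [|k] /=; first by rewrite !mul0r.
  by rewrite [rek_rate A ^+ k.+1]exprSr; ring.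
by rewrite -natr1; ring.
Qed.

(** * The geometric factor *)

(** The k + 1 powers 1, ..., a^k are all at least a^k, and their sum times 1 - a
    is 1 - a^(k+1). *)
Lemma geometric_peak {R : realType} (a : R) k :
  0 <= a <= 1 -> k.+1%:R * a ^+ k * (1 - a) <= 1.
Proof.
case/andP=> a0 a1.
suff h : k.+1%:R * a ^+ k * (1 - a) <= 1 - a ^+ k.+1.
  by apply: le_trans h _; rewrite gerBl exprn_ge0.
elim: k => [|k IH]; first by rewrite expr0 mul1r mul1r.
have h := ler_wpM2l a0 IH.
have p1 : 0 <= (1 - a) * (1 - a ^+ k.+1).
  by rewrite mulr_ge0 ?subr_ge0 ?exprn_ile1.
by rewrite -[k.+2%:R]natr1 !exprS in h p1 *; lra.
Qed.

(** Split a^(T-1) = a^k a^(T/2), where T <= 2 (k + 1), and apply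
    [geometric_peak] to the first factor. *)
Lemma geometric_half {R : realType} (a : R) T :
  0 <= a <= 1 -> (0 < T)%N -> T%:R * a ^+ T.-1 * (1 - a) <= 2 * a ^+ T./2.
Proof.
move=> a01 T0; have /andP[a0 a1] := a01.
pose k := (T.-1 - T./2)%N.
have Tk : T.-1 = (k + T./2)%N.
  by rewrite subnK //; have := odd_double_half T; case: (T) T0 => // t _; lia.
have T2 : (T <= 2 * k.+1)%N by have := odd_double_half T; lia.
have := geometric_peak a k a01; rewrite Tk exprD.
have p0 : 0 <= a ^+ T./2 by exact: exprn_ge0.
have q0 : 0 <= a ^+ k * (1 - a) by rewrite mulr_ge0 ?exprn_ge0 ?subr_ge0.
move: T2; rewrite -(ler_nat R) natrM => T2 h.
rewrite mulrCA -!mulrA [a ^+ T./2 * _]mulrC. 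
have : T%:R * (a ^+ k * (1 - a)) <= 2%:R * k.+1%:R * (a ^+ k * (1 - a)).
  by rewrite ler_wpM2r.
move=> h2.
have : T%:R * (a ^+ k * (1 - a)) * a ^+ T./2 <= 2 * a ^+ T./2.
  by rewrite ler_wpM2r //; apply: le_trans h2 _; lra.
by lra.
Qed.

(** * The convergence bound *)

Theorem theorem8 (R : realType) (m n : nat) (A : 'M[R]_(m, n)) (b : 'cV[R]_m)
    (hA : A != 0) (T : nat) (hT : (1 < T)%N) :
  rek_expectation A (fun w : T.-tuple ('I_m * 'I_n) =>
      norm2 (rek_x A b w - x_LS A b) ^+ 2)
    <= (1 - 1 / kappaF_sq A) ^+ T./2 * (1 + 2 * kappa_sq A)
       * norm2 (x_LS A b) ^+ 2.
Proof.
have [AXA XAX _ _] := mpinvP A; set xs := x_LS A b.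
have xsE : mpinv A *m A *m xs = xs by rewrite /xs /x_LS mulmxA XAX.
have F0 := normF_sq_gt0 A hA.
have tp := specnorm_gt0 _ (mpinv_neq0 A hA).
have r01 : 0 <= rek_rate A <= 1 by rewrite rek_rate_ge0 // rek_rate_le1.
have := rek_value_bound A b T 0 b hA.
rewrite /= -/xs sub0r subKr mulmxN xsE mulmxA AXA.
move=> /(_ erefl erefl) h; apply: le_trans; first exact: h.
rewrite -/(rek_rate A).
have xs0 : 0 <= norm2 xs ^+ 2 by exact: sqr_ge0.
have nN : norm2 (- xs) ^+ 2 = norm2 xs ^+ 2.
  by rewrite !norm2_sq dotNl dotNr opprK.
have hs : norm2 (A *m xs) ^+ 2 <= sigma_max A ^+ 2 * norm2 xs ^+ 2.
  rewrite !norm2_sq; apply: le_trans (specnorm_bound _ _) _.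
  rewrite ler_wpM2r ?dot_ge0 //.
  have := specnorm_le_sigma_max A hA; have := specnorm_ge0 A.
  by move=> s0 sm; rewrite ler_sqr ?nnegrE // (le_trans s0).
(* Both sides are (sigma_max / F)^2, since 1 - r = 1 / (F t)^2 and
   kappa^2 = (sigma_max t)^2. *)
have kE : sigma_max A ^+ 2 / normF A ^+ 2 = (1 - rek_rate A) * kappa_sq A.
  rewrite /rek_rate /kappa_sq sigma_minE // /kappaF_sq.
  field; rewrite gt_eqF //=; apply: contraTneq F0 => ->.
  by rewrite expr0n ltxx.
have k0 : 0 <= kappa_sq A by rewrite divr_ge0 ?sqr_ge0.
have hT2 : rek_rate A ^+ T <= rek_rate A ^+ T./2.
  have /andP[r0 r1] := r01; rewrite ler_wiXn2l //.
  by have := odd_double_half T; lia.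
have hg := geometric_half (rek_rate A) T r01 (ltnW hT).
set r := rek_rate A in kE hT2 hg *.
have c0 : 0 <= T%:R * r ^+ T.-1 / normF A ^+ 2.
  by rewrite divr_ge0 ?(ltW F0) // mulr_ge0 ?exprn_ge0 //; case/andP: r01.
rewrite nN mulrDr mulr1 mulrDl; apply: lerD; first by rewrite ler_wpM2r.
apply: le_trans (ler_wpM2l c0 hs) _.
rewrite mulrA ler_wpM2r // mulrAC -mulrA kE mulrA.
by apply: le_trans (ler_wpM2r k0 hg) _; lra.
Qed.
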